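(* There exists a monotone parallel dynamical system $(G,f)$ that does not have a monotone sequentialization.
   Context: Let $G$ be a simple graph with vertex set $\{1,\dots,n\}$, each vertex having a state in $\mathbb{F}_2=\{0,1\}$, and let each vertex $i$ have a local function $f_i$ whose arguments are the states of $i$ and its neighbours in $G$. Order $\mathbb{F}_2^n$ componentwise with $0<1$; a local function is monotone if $X\le Y$ implies $f_i(X)\le f_i(Y)$. The parallel dynamical system $(G,f)$ is the map $\mathbb{F}_2^n\to\mathbb{F}_2^n$ updating all vertices simultaneously, $X\mapsto[f_1(X),\dots,f_n(X)]$; it is monotone if all $f_i$ are monotone. A sequential dynamical system (SDS) $(G',f',\pi)$ consists of a graph $G'$ on a vertex set, local functions $f'_i$ (of the states of $i$ and its $G'$-neighbours), and a permutation $\pi=\pi_1\cdots\pi_n$ of the vertices; with $F'_i$ the map replacing coordinate $i$ by the value of $f'_i$ and fixing the other coordinates, it defines the map $F'_{\pi}=F'_{\pi_n}\circ\cdots\circ F'_{\pi_1}$. A monotone sequentialization of $(G,f)$ is an SDS $(G',f',\pi)$ with $V(G')=V(G)$ and all $f'_i$ monotone such that $F'_\pi$ equals the map of the parallel system $(G,f)$. *)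

(* Defs.v *)
From mathcomp Require Import all_boot all_order all_fingroup all_algebra.

Set Implicit Arguments.
Unset Strict Implicit.
Unset Printing Implicit Defensive.

Record sgraph (n : nat) := SGraph {
  adj :> rel 'I_n;
  adj_sym : symmetric adj;
  adj_irrefl : irreflexive adj
}.

Definition state (n : nat) := {ffun 'I_n -> 'F_2}.

(* The comparison is on the representatives 0 and 1 of 'F_2 in nat. *)
Definition state_le (n : nat) (X Y : state n) : Prop :=
  forall j : 'I_n, (X j <= Y j)%N.

Definition agree_on_nbhd (n : nat) (G : sgraph n) (i : 'I_n) (X Y : state n) :
    Prop :=
  forall j : 'I_n, (j == i) || G i j -> X j = Y j.

(* A function of the states of i and of its neighbours is represented by a
   function on all states that depends only on those coordinates. *)
Record local_functions (n : nat) (G : sgraph n) := LocalFunctions {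
  local_fun :> 'I_n -> state n -> 'F_2;
  local_funP : forall (i : 'I_n) (X Y : state n),
    agree_on_nbhd G i X Y -> local_fun i X = local_fun i Y
}.

Definition monotone_local (n : nat) (G : sgraph n) (f : local_functions G) :
    Prop :=
  forall (i : 'I_n) (X Y : state n),
    state_le X Y -> (f i X <= f i Y)%N.

Definition parallel_map (n : nat) (G : sgraph n) (f : local_functions G)
    (X : state n) : state n :=
  [ffun i => f i X].

Definition vertex_update (n : nat) (G : sgraph n) (f : local_functions G)
    (i : 'I_n) (X : state n) : state n :=
  [ffun j => if j == i then f i X else X j].

(* p 0, p 1, ... is the update order: p 0 is updated first. *)
Definition sds_map (n : nat) (G : sgraph n) (f : local_functions G) (p : 'S_n)
    (X : state n) : state n :=
  foldl (fun Y i => vertex_update f i Y) X [seq p k | k <- enum 'I_n].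

Definition monotone_sequentialization (n : nat) (G : sgraph n)
    (f : local_functions G) (G' : sgraph n) (f' : local_functions G')
    (p : 'S_n) : Prop :=
  monotone_local f' /\ sds_map f' p =1 parallel_map f.

(* Main.v *)
Require Import Defs.
From mathcomp Require Import all_boot all_order all_fingroup all_algebra.

(** The counterexample is the swap [(x, y) |-> (y, x)] on the single edge.  The
    vertex updated first never changes again, so it must receive the old state
    of the other vertex; this overwrites its own state, which the second update
    can then no longer recover. *)

Definition single_edge : sgraph 2.
Proof.
by apply: (@SGraph 2 [rel i j | i != j]) => [i j | i] /=;
  rewrite ?eqxx // eq_sym.
Defined.

(** On ['I_2], [rev_ord] exchanges the two vertices. *)
Definition swap_functions : local_functions single_edge.
Proof.
apply: (@LocalFunctions 2 single_edge (fun i X => X (rev_ord i))) => i X Y.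
(* Every vertex is [i] or a neighbour of [i], in particular [rev_ord i]. *)
by apply; rewrite /= [i == _]eq_sym orbN.
Defined.

Lemma ord2_rev (i j : 'I_2) : i != j -> rev_ord i = j.
Proof.
by case: i j => [[|[|//]] ?] [[|[|//]] ?] // _; apply: val_inj.
Qed.

Lemma sds_map2 (G : sgraph 2) (f : local_functions G) (p : 'S_2) (X : state 2) :
  sds_map f p X =
  vertex_update f (p ord_max) (vertex_update f (p ord0) X).
Proof.
rewrite /sds_map enum_ordSl enum_ordSl /=.
have -> : enum 'I_0 = [::] by apply: size0nil; rewrite size_enum_ord.
by congr (vertex_update f (p _) _); apply: val_inj.
Qed.

Lemma swap_not_sequentializable (G : sgraph 2) (f : local_functions G)
    (p : 'S_2) :
  ~ (sds_map f p =1 parallel_map swap_functions).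
Proof.
set a := p ord0; set b := p ord_max => seq_swap.
have neq_ab : a != b by rewrite (inj_eq perm_inj).
have rev_a : rev_ord a = b by apply: ord2_rev.
have rev_b : rev_ord b = a by apply: ord2_rev; rewrite eq_sym.
(* The second update, at [b], leaves coordinate [a] alone, so its final value is already [f a X]. *)
have fa X : f a X = X b.
  have := congr1 (fun Y : state 2 => Y a) (seq_swap X).
  by rewrite sds_map2 !ffunE (negPf neq_ab) eqxx /= rev_a.
(* Two states that differ only at [a], the coordinate that the first update overwrites with the
   value at [b]. *)
pose X0 : state 2 := [ffun => 0%R].
pose X1 : state 2 := [ffun j => (j == a)%:R%R].
have first_eq : vertex_update f a X1 = vertex_update f a X0.
  apply/ffunP=> j; rewrite !ffunE !fa !ffunE [b == a]eq_sym (negPf neq_ab).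
  by case: eqP.
have swap_eq : parallel_map swap_functions X1 = parallel_map swap_functions X0.
  by rewrite -!seq_swap !sds_map2 -/a first_eq.
(* The swap carries the old value at [a] to [b], so comparing at [b] gives 1 = 0. *)
have := congr1 (fun Y : state 2 => Y b) swap_eq.
by rewrite !ffunE /= rev_b !ffunE eqxx.
Qed.

Theorem theorem4p2 :
  exists (n : nat) (G : sgraph n) (f : local_functions G),
    monotone_local f /\
    ~ (exists (G' : sgraph n) (f' : local_functions G') (p : 'S_n),
         monotone_sequentialization f f' p).
Proof.
(* Each local function is a coordinate projection, hence monotone. *)
exists 2, single_edge, swap_functions; split; first by move=> i X Y; apply.
by case=> G' [f' [p [_ /swap_not_sequentializable]]].
Qed.
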